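(* Let $n\ge2$, $1\le k\le n-1$, let $\theta\in\mathbb S_{A+}$ and let $\xi\in G_k(\theta^\perp)$ be such that the $k$-chord $h(\theta,\xi)$ is tangent to the equator. If $f(x)\equiv f_0(x_n)$, $x\in\mathbb B_+$, then $$(If)(\theta,\xi)=a\,F(2b),$$ where $$a=\pi^{(k-1)/2}(1-\theta_n^2)^{-k/2},\qquad b=\theta_n\sqrt{1-\theta_n^2},$$ $$F(r)=\frac{1}{\Gamma((k+1)/2)}\int_0^r f_1(s)\,(r-s)^{(k-1)/2}\,ds,\qquad f_1(s)=f_0(s)\,s^{(k-1)/2}.$$ It is assumed that the integral on either side exists in the Lebesgue sense.
   Context: $\mathbb B=\{x\in\mathbb R^n:|x|<1\}$, $\mathbb B_+=\{x\in\mathbb B:x_n>0\}$, $\mathbb S_+=\{\theta\in\mathbb S^{n-1}:\theta_n>0\}$, $e_n=(0,\dots,0,1)$, $d(\cdot,\cdot)$ is the geodesic distance on $\mathbb S^{n-1}$; the equator is $\{x\in\mathbb S^{n-1}:x_n=0\}$; $\mathbb S_{A+}=\{\theta\in\mathbb S_+:0<d(e_n,\theta)\le\pi/4\}$, i.e. $1/\sqrt2\le\theta_n<1$. $G_k(\theta^\perp)$ is the set of $k$-dimensional linear subspaces of $\theta^\perp=\{x: x\cdot\theta=0\}$. For $\theta\in\mathbb S_+$, $\xi\in G_k(\theta^\perp)$, the $k$-chord is $$h(\theta,\xi)=\{\theta_n\eta+\sqrt{1-\theta_n^2}\,\theta:\ \eta\in\mathbb B\cap\xi\}.$$ It is a cross-section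 of $\mathbb B_+$ tangent to the equator when it lies in $\mathbb B_+$ and its closure meets the equator in exactly one point; equivalently (for $0<\theta_n<1$), $e_n-\theta_n\theta\in\xi$ (automatic if $k=n-1$). The integral of $f$ over the chord is $$(If)(\theta,\xi)=\theta_n^k\int_{\mathbb B\cap\xi} f\big(\theta_n\eta+\sqrt{1-\theta_n^2}\,\theta\big)\,d\eta,$$ with $d\eta$ Lebesgue measure on $\xi$. *)

(* Defs.v *)
From HB Require Import structures.
From mathcomp Require Import all_boot all_order all_algebra.
From mathcomp Require Import all_classical all_reals all_analysis.

Set Implicit Arguments.
Unset Strict Implicit.
Unset Printing Implicit Defensive.

Import Order.TTheory GRing.Theory Num.Theory.
Import numFieldNormedType.Exports.

Local Open Scope classical_set_scope.
Local Open Scope ring_scope.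

(* [R^n] with [n >= 1] is ['rV[R]_m.+1] with [n = m.+1]; the coordinate [x_n] is
   then indexed by [ord_max].
   The norm [`|x|] that the library puts on ['rV[R]_n] is the sup norm, hence
   the explicit Euclidean scalar product and norm below. *)
Definition dotv (R : realType) n (u v : 'rV[R]_n) : R :=
  \sum_(i < n) u 0 i * v 0 i.

Definition enorm (R : realType) n (u : 'rV[R]_n) : R := Num.sqrt (dotv u u).

Definition e_last (R : realType) m : 'rV[R]_m.+1 := delta_mx 0 ord_max.

Definition last_coord (R : realType) m (x : 'rV[R]_m.+1) : R := x 0 ord_max.

Definition unit_ball (R : realType) m : set 'rV[R]_m.+1 :=
  [set x | enorm x < 1].

Definition half_ball (R : realType) m : set 'rV[R]_m.+1 :=
  [set x | unit_ball x /\ 0 < last_coord x].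

Definition unit_sphere (R : realType) m : set 'rV[R]_m.+1 :=
  [set x | enorm x = 1].

Definition half_sphere (R : realType) m : set 'rV[R]_m.+1 :=
  [set x | unit_sphere x /\ 0 < last_coord x].

Definition equator (R : realType) m : set 'rV[R]_m.+1 :=
  [set x | unit_sphere x /\ last_coord x = 0].

(* only meaningful for [x] and [y] on the unit sphere *)
Definition geodesic_dist (R : realType) m (x y : 'rV[R]_m.+1) : R :=
  acos (dotv x y).

Definition sphere_Aplus (R : realType) m : set 'rV[R]_m.+1 :=
  [set theta | half_sphere theta /\
     0 < geodesic_dist (e_last R m) theta <= pi / 4].

Definition grassmannian_perp (R : realType) m (k : nat) (theta : 'rV[R]_m.+1) :
    set {vspace 'rV[R]_m.+1} :=
  [set xi | \dim xi = k /\ forall x, x \in xi -> dotv x theta = 0].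

Definition chord_point (R : realType) m (theta eta : 'rV[R]_m.+1) :
    'rV[R]_m.+1 :=
  last_coord theta *: eta + Num.sqrt (1 - last_coord theta ^+ 2) *: theta.

Definition chord (R : realType) m (theta : 'rV[R]_m.+1)
    (xi : {vspace 'rV[R]_m.+1}) : set 'rV[R]_m.+1 :=
  [set chord_point theta eta | eta in @unit_ball R m `&` [set` xi]].

Definition tangent_to_equator (R : realType) m (h : set 'rV[R]_m.+1) : Prop :=
  h `<=` @half_ball R m /\
  exists p, closure h `&` @equator R m = [set p].

Section OrthonormalBasis.
Variables (R : realType) (n : nat).
Implicit Types (u v w : 'rV[R]_n) (s : seq 'rV[R]_n).

Lemma dotvC u v : dotv u v = dotv v u.
Proof. by apply: eq_bigr => i _; rewrite mulrC. Qed.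

Lemma dotvDl u v w : dotv (u + v) w = dotv u w + dotv v w.
Proof. by rewrite -big_split; apply: eq_bigr => i _; rewrite mxE mulrDl. Qed.

Lemma dotvZl a u w : dotv (a *: u) w = a * dotv u w.
Proof. by rewrite mulr_sumr; apply: eq_bigr => i _; rewrite mxE mulrA. Qed.

Lemma dotv0l w : dotv 0 w = 0.
Proof. by apply: big1 => i _; rewrite mxE mul0r. Qed.

Lemma dotv_suml I (r : seq I) (F : I -> 'rV[R]_n) w :
  dotv (\sum_(i <- r) F i) w = \sum_(i <- r) dotv (F i) w.
Proof.
elim: r => [|i r IH]; first by rewrite !big_nil dotv0l.
by rewrite !big_cons dotvDl IH.
Qed.

Lemma dotv_ge0 u : 0 <= dotv u u.
Proof. by apply: sumr_ge0 => i _; rewrite -expr2 sqr_ge0. Qed.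

Lemma dotv_eq0 u : (dotv u u == 0) = (u == 0).
Proof.
apply/eqP/eqP => [|->]; last exact: dotv0l.
move=> u0; apply/rowP => i; rewrite mxE; apply/eqP.
rewrite -sqrf_eq0 expr2.
have/psumr_eq0P := u0; move=> -> // j _.
by rewrite -expr2 sqr_ge0.
Qed.

Definition orthonormal_seq s :=
  forall i j, (i < size s)%N -> (j < size s)%N ->
    dotv s`_i s`_j = (i == j)%:R.

Definition orthonormal_basis (xi : {vspace 'rV[R]_n}) k (U : k.-tuple 'rV[R]_n)
    : bool :=
  basis_of xi U &&
  [forall i, forall j, dotv (tnth U i) (tnth U j) == (i == j)%:R].

Lemma orthonormal_free s : orthonormal_seq s -> free s.
Proof.
move=> os; rewrite -[s]/(val (in_tuple s)); apply/freeP => a a0 i.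
have := congr1 (fun v => dotv v s`_i) a0; rewrite dotv0l dotv_suml.
rewrite (bigD1 i)//= big1 => [|j ji].
  by rewrite addr0 dotvZl os// eqxx mulr1.
by rewrite dotvZl os// (inj_eq val_inj) (negPf ji) mulr0.
Qed.

Lemma gram_schmidt s :
  exists2 t, orthonormal_seq t & span t = span s.
Proof.
elim: s => [|x s [t ot ts]]; first by exists [::].
pose p : 'rV[R]_n := \sum_(i < size t) dotv x t`_i *: t`_i.
have pt : p \in span t.
  by apply: memv_suml => i _; apply: memvZ; apply/memv_span/mem_nth.
have wt (i : nat) : (i < size t)%N -> dotv (x - p) t`_i = 0.
  move=> it; rewrite -scaleN1r dotvDl dotvZl dotv_suml.
  rewrite (bigD1 (Ordinal it))//= big1 => [|j ji].
    by rewrite dotvZl ot// eqxx mulr1 addr0 mulN1r subrr.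
  by rewrite dotvZl ot// -(inj_eq val_inj) /= in ji *; rewrite (negPf ji) mulr0.
have [w0|w0] := eqVneq (x - p) 0.
  exists t => //; rewrite span_cons -ts; apply/esym/addv_idPr.
  by rewrite -memvE; move/eqP: w0; rewrite subr_eq0 => /eqP ->.
pose c := Num.sqrt (dotv (x - p) (x - p)).
have c0 : c != 0 by rewrite sqrtr_eq0 -ltNge lt_def dotv_eq0 w0 dotv_ge0.
exists (c^-1 *: (x - p) :: t).
  move=> [|i] [|j] //=; rewrite ?ltnS => ti tj.
  - rewrite dotvZl dotvC dotvZl mulrA.
    rewrite -[dotv _ _]sqr_sqrtr ?dotv_ge0// -/c expr2.
    by rewrite mulrACA mulVf// mul1r.
  - by rewrite dotvZl wt// mulr0.
  - by rewrite dotvC dotvZl wt// mulr0.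
  - by rewrite ot// eqSS.
rewrite !span_cons -ts; apply/eqP; rewrite eqEsubv !subv_add !addvSr !andbT.
rewrite -!memvE; apply/andP; split.
  apply: memvZ; apply: memv_add; first exact: memv_line.
  by rewrite memvN.
rewrite -[x in x \in _](subrK p) memv_add//.
by apply/vlineP; exists c; rewrite scalerA mulfV// scale1r.
Qed.

Lemma orthonormal_basis_exists (xi : {vspace 'rV[R]_n}) :
  exists U : (\dim xi).-tuple 'rV[R]_n, orthonormal_basis xi U.
Proof.
have [t ot] := gram_schmidt (vbasis xi).
rewrite (span_basis (vbasisP xi)) => txi.
have ft := orthonormal_free ot.
have st : size t == \dim xi by rewrite -txi; rewrite -[_ == _]/(_ == _) eq_sym.
exists (Tuple st); apply/andP; split; first by rewrite basisEdim/= txi subvv (eqP st) leqnn.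
apply/forallP => i; apply/forallP => j.
by rewrite !(tnth_nth 0)/= ot ?(eqP st).
Qed.

(* The choice is immaterial for what follows: Lebesgue measure is invariant
   under orthogonal changes of coordinates. *)
Definition onb (xi : {vspace 'rV[R]_n}) : (\dim xi).-tuple 'rV[R]_n :=
  xchoose (orthonormal_basis_exists xi).

Definition onb_point (xi : {vspace 'rV[R]_n}) (y : (\dim xi).-tuple R) :
    'rV[R]_n :=
  \sum_(i < \dim xi) tnth y i *: tnth (onb xi) i.

End OrthonormalBasis.

Section LebesgueTuple.
Variable R : realType.
Local Notation RT := (measurableTypeR R).

Definition cons_pair k (p : RT * k.-tuple RT) : k.+1.-tuple RT :=
  [tuple of p.1 :: p.2].

Lemma measurable_cons_pair k : measurable_fun setT (@cons_pair k).
Proof. exact: measurable_cons. Qed.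

Section Step.
Variables (k : nat) (mu : {sigma_finite_measure set (k.-tuple RT) -> \bar R}).

Definition lebesgue_cons : set (k.+1.-tuple RT) -> \bar R :=
  pushforward (@lebesgue_measure R \x mu)%E (@cons_pair k).

Let preimage_cons_measurable (A : set (k.+1.-tuple RT)) :
  measurable A -> measurable (@cons_pair k @^-1` A).
Proof.
by move=> mA; rewrite -[X in measurable X]setTI; exact: measurable_cons_pair.
Qed.

Let lebesgue_cons0 : lebesgue_cons set0 = 0%E.
Proof. by rewrite /lebesgue_cons /pushforward preimage_set0 measure0. Qed.

Let lebesgue_cons_ge0 A : (0 <= lebesgue_cons A)%E.
Proof. by rewrite /lebesgue_cons /pushforward; apply: measure_ge0. Qed.

Let lebesgue_cons_sigma_additive : semi_sigma_additive lebesgue_cons.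
Proof.
move=> F mF tF mUF; rewrite /lebesgue_cons /pushforward preimage_bigcup.
apply: measure_semi_sigma_additive.
- by move=> i; exact: preimage_cons_measurable.
- apply/trivIsetP => /= i j _ _ ij; rewrite -preimage_setI.
  by move/trivIsetP : tF => /(_ _ _ _ _ ij) ->//; rewrite preimage_set0.
- by rewrite -preimage_bigcup; exact: preimage_cons_measurable.
Qed.

HB.instance Definition _ := isMeasure.Build _ _ _ lebesgue_cons
  lebesgue_cons0 lebesgue_cons_ge0 lebesgue_cons_sigma_additive.

Let lebesgue_cons_sigma_finite : sigma_finite setT lebesgue_cons.
Proof.
have /sigma_finiteP[F [TF ndF Foo]] := sigma_finiteT (@lebesgue_measure R).
have /sigma_finiteP[G [TG ndG Goo]] := sigma_finiteT mu.
pose g (t : k.+1.-tuple RT) := (thead t, [tuple of behead t]).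
have gK (t : k.+1.-tuple RT) : cons_pair (g t) = t.
  by rewrite [RHS]tuple_eta; exact/val_inj.
have mg : measurable_fun setT g.
  apply/measurable_fun_pairP; split; last exact: measurable_behead.
  exact: (measurable_tnth ord0).
exists (fun i => g @^-1` (F i `*` G i)).
  rewrite -preimage_bigcup -[LHS](preimage_setT g); congr (_ @^-1` _).
  rewrite -setXTT TF TG predeqE => -[x y]; split.
    move=> [/= [i _ Fix] [j _ Gjy]]; exists (maxn i j) => //; split.
    - by move: x Fix; exact/subsetPset/ndF/leq_maxl.
    - by move: y Gjy; exact/subsetPset/ndG/leq_maxr.
  by move=> [i _ []/= ? ?]; split; exists i.
move=> i; have [mF Fi] := Foo i; have [mG Gi] := Goo i; split.
  by rewrite -[X in measurable X]setTI; apply: mg => //; exact: measurableX.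
rewrite /lebesgue_cons /pushforward -comp_preimage.
rewrite (_ : g \o _ = id); last first.
  by rewrite funeqE => -[x t] /=; congr pair; exact/val_inj.
by rewrite preimage_id product_measure1E// lte_mul_pinfty// ge0_fin_numE.
Qed.

HB.instance Definition _ := Measure_isSigmaFinite.Build _ _ _ lebesgue_cons
  lebesgue_cons_sigma_finite.

End Step.

Fixpoint lebesgue_tuple k : {sigma_finite_measure set (k.-tuple RT) -> \bar R} :=
  match k with
  | 0 => \d_([tuple] : 0.-tuple RT)
  | k'.+1 => lebesgue_cons (lebesgue_tuple k')
  end.

End LebesgueTuple.

Section SubspaceIntegral.
Variables (R : realType) (m : nat).
Implicit Types (theta : 'rV[R]_m.+1) (xi : {vspace 'rV[R]_m.+1}).

(* Integrability with respect to the completion of [mu]: the library's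
   [mu.-integrable] asks for measurability with respect to the sigma-algebra of
   [mu] (Borel sets for Lebesgue measure), whereas a Lebesgue integrable
   function need only agree almost everywhere with such a function. The library
   integral of [f] is then the Lebesgue integral of [f], because it is defined
   by suprema over measurable simple functions below [f^\+] and [f^\-], and
   these are not affected by changing [f] on a negligible set. *)
Definition lebesgue_integrable d (T : measurableType d)
    (mu : {measure set T -> \bar R}) (D : set T) (f : T -> R) : Prop :=
  exists2 g : T -> R, mu.-integrable D (EFin \o g) &
    {ae mu, forall x, D x -> f x = g x}.

(* [B `&` xi] in the coordinates given by the orthonormal basis [onb xi] *)
Definition ball_coords xi : set ((\dim xi).-tuple (measurableTypeR R)) :=
  [set y | unit_ball (onb_point (y : (\dim xi).-tuple R))].

Definition chord_integrand (f : 'rV[R]_m.+1 -> R) theta xi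
    (y : (\dim xi).-tuple (measurableTypeR R)) : R :=
  f (chord_point theta (onb_point (y : (\dim xi).-tuple R))).

Definition chord_integrable (f : 'rV[R]_m.+1 -> R) theta xi : Prop :=
  lebesgue_integrable (lebesgue_tuple R (\dim xi))
    (ball_coords (xi := xi)) (chord_integrand f theta (xi := xi)).

Definition chord_integral (f : 'rV[R]_m.+1 -> R) theta xi : R :=
  last_coord theta ^+ \dim xi *
  \int[lebesgue_tuple R (\dim xi)]_(y in ball_coords (xi := xi))
    chord_integrand f theta y.

End SubspaceIntegral.

Section AbelType.
Variable R : realType.

(* meant for [0 < x] *)
Definition Gamma (x : R) : R :=
  \int[@lebesgue_measure R]_(t in `]0, +oo[) (t `^ (x - 1) * expR (- t)).

Definition f1 (k : nat) (f0 : R -> R) (s : R) : R := f0 s * s `^ ((k%:R - 1) / 2).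

Definition F_integrand (k : nat) (f0 : R -> R) (r s : R) : R :=
  f1 k f0 s * (r - s) `^ ((k%:R - 1) / 2).

Definition F_integrable (k : nat) (f0 : R -> R) (r : R) : Prop :=
  lebesgue_integrable (@lebesgue_measure R) `]0, r[ (F_integrand k f0 r).

Definition F (k : nat) (f0 : R -> R) (r : R) : R :=
  (Gamma ((k%:R + 1) / 2))^-1 *
  \int[@lebesgue_measure R]_(s in `]0, r[) F_integrand k f0 r s.

End AbelType.

(* Main.v *)
Require Import Defs.
From HB Require Import structures.
From mathcomp Require Import all_boot all_order all_algebra.
From mathcomp Require Import all_classical all_reals all_analysis.
From mathcomp Require Import measurable_realfun ring lra.

(* On the chord [x_n = b (1 + w . y)], where [y] are the coordinates of [eta] in
   the orthonormal basis of [xi] and [w] is the normalized projection of [e_n]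
   to [xi]; tangency says exactly that this projection has norm
   [sqrt (1 - theta_n^2)]. A rotation taking [w] to the first axis turns the
   integrand into a function of [u = b (1 + y_1)] alone, and by Fubini it is
   integrated against the volume of the [(k-1)]-dimensional ball of squared
   radius [u (2 b - u) / b^2], which is the Abel kernel. The constant is the
   volume of the unit ball, computed from the Gaussian integral. *)

Set Implicit Arguments.
Unset Strict Implicit.
Unset Printing Implicit Defensive.

Import Order.TTheory GRing.Theory Num.Theory.
Import numFieldNormedType.Exports.

Local Open Scope classical_set_scope.
Local Open Scope ring_scope.

(** Since [f0] is an arbitrary function and integrability is understood up to null sets, existence
    of either side has to be turned into existence of the other. Every change of variables therefore
    carries integrability in both directions, through a bijection measurable both ways that
    multiplies measure by a constant. The delicate point is Fubini for a function of [u] alone: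
    almost everywhere measurability has to pass between the solid region and the line, where the
    weight vanishes outside []0, 2 * b[]. Lebesgue measure on tuples is an iterated product, so the
    maps directly available move one factor with the other as a parameter; hence the rotation is
    built from shears. One power of [b] in the constant comes from the substitution of [u] and
    [k - 1] from the radius of the sections. *)

(** * Integrals of functions that agree almost everywhere *)

Section AlmostEverywhere.
Context d (T : measurableType d) (R : realType).
Variable mu : {measure set T -> \bar R}.
Local Open Scope ereal_scope.
Import HBNNSimple.

(** Neither function is assumed measurable: the integral is a supremum over simple functions below
    [f], and each of these, set to zero on the null set [N], lies below [g] and keeps its
    integral. *)
Lemma ge0_le_integral_ae (f g : T -> \bar R) :
  (forall x, 0 <= f x) -> (forall x, 0 <= g x) ->
  {ae mu, forall x, f x = g x} -> \int[mu]_x f x <= \int[mu]_x g x.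
Proof.
move=> f0 g0 [N [mN N0 subN]].
rewrite !ge0_integralTE//; apply: ge_ereal_sup => _ [h hf <-].
pose h' := mul_nnsfun h (indic_nnsfun R (measurableC mN)).
apply: ereal_sup_ubound; exists h' => /=.
  move=> x; rewrite /= mindicE in_setC; case: (boolP (x \in N)) => xN /=.
    by rewrite mulr0.
  rewrite mulr1; have := hf x; congr (_ <= _).
  by apply: contrapT => fg; move: xN; rewrite notin_setE; apply; apply: subN.
rewrite -!integralT_nnsfun; apply: ae_eq_integral => //.
- exact/measurable_EFinP.
- exact/measurable_EFinP.
exists N; split => // x /= hh'; apply: contrapT => xN; apply: hh' => _.
by rewrite /= mindicE in_setC memNset// mulr1.
Qed.

Lemma integral_ae (D : set T) (f g : T -> \bar R) :
  {ae mu, forall x, D x -> f x = g x} ->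
  \int[mu]_(x in D) f x = \int[mu]_(x in D) g x.
Proof.
move=> fg; rewrite integral_mkcond [RHS]integral_mkcond.
have {}fg : {ae mu, forall x, (f \_ D) x = (g \_ D) x}.
  apply: filterS fg => x fg; rewrite !patchE; case: ifPn => // xD.
  by apply: fg; rewrite inE in xD.
have gf : {ae mu, forall x, (g \_ D) x = (f \_ D) x} by apply: filterS fg.
rewrite integralE [RHS]integralE; congr (_ - _); apply/eqP; rewrite eq_le;
  apply/andP; split; apply: ge0_le_integral_ae => //.
- by apply: filterS fg => x; rewrite !funeposE => ->.
- by apply: filterS gf => x; rewrite !funeposE => ->.
- by apply: filterS fg => x; rewrite !funenegE => ->.
- by apply: filterS gf => x; rewrite !funenegE => ->.
Qed.

End AlmostEverywhere.

(** * Integrability with respect to the completed measure *)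

Section LebesgueIntegrable.
Context d (T : measurableType d) (R : realType).
Variable mu : {measure set T -> \bar R}.
Implicit Types (D : set T) (f g : T -> R).

Lemma Rintegral_ae D f g : {ae mu, forall x, D x -> f x = g x} ->
  \int[mu]_(x in D) f x = \int[mu]_(x in D) g x.
Proof.
move=> fg; congr fine; apply: integral_ae.
by apply: filterS fg => x fg Dx; rewrite fg.
Qed.

Lemma eq_lebesgue_integrable D f g : {in D, f =1 g} ->
  lebesgue_integrable mu D f -> lebesgue_integrable mu D g.
Proof.
move=> fg [u iu fu]; exists u => //; apply: filterS fu => x fu Dx.
by rewrite -fg ?inE//; exact: fu.
Qed.

Lemma lebesgue_integrable_mkcond D f : measurable D ->
  lebesgue_integrable mu D f <-> lebesgue_integrable mu setT (f \_ D).
Proof.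
move=> mD; split=> -[g ig fg].
  exists (g \_ D).
    by rewrite -restrict_EFin; exact/(integrable_mkcond _ mD).
  apply: filterS fg => x fg _; rewrite !patchE; case: ifPn => // xD.
  by apply: fg; rewrite inE in xD.
exists g; first exact: integrableS ig.
by apply: filterS fg => x /(_ I) <- Dx; rewrite patchE mem_set.
Qed.

Lemma lebesgue_integrableZl D f c : measurable D ->
  lebesgue_integrable mu D f -> lebesgue_integrable mu D (fun x => c * f x).
Proof.
move=> mD [g ig fg]; exists (fun x => c * g x).
  rewrite (_ : _ \o _ = fun x => (c%:E * (EFin \o g) x)%E) //.
  exact: integrableZl.
by apply: filterS fg => x fg Dx; rewrite fg.
Qed.

Lemma lebesgue_RintegralZl D f c : measurable D ->
  lebesgue_integrable mu D f ->
  \int[mu]_(x in D) (c * f x) = c * \int[mu]_(x in D) f x.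
Proof.
move=> mD [g ig fg]; rewrite (Rintegral_ae fg) -RintegralZl//.
by apply: Rintegral_ae; apply: filterS fg => x fg Dx; rewrite fg.
Qed.

End LebesgueIntegrable.

(** * Maps that multiply measure by a constant *)

Section ScalingMaps.
Variable R : realType.

(** The pushforward of [mu] is [c] times [nu]; for a linear bijection [c] is the inverse of the
    absolute determinant. *)
Definition scales_measure d1 d2 (T1 : measurableType d1) (T2 : measurableType d2)
    (mu : {measure set T1 -> \bar R}) (nu : {measure set T2 -> \bar R})
    (c : R) (phi : T1 -> T2) : Prop :=
  measurable_fun setT phi /\
  forall A, measurable A -> mu (phi @^-1` A) = (c%:E * nu A)%E.

(** The inverse is part of the data because integrability of [f] is recovered from that of
    [f \o phi] by composing with [psi]. *)
Definition scaling_iso d1 d2 (T1 : measurableType d1) (T2 : measurableType d2)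
    (mu : {measure set T1 -> \bar R}) (nu : {measure set T2 -> \bar R})
    (c : R) (phi : T1 -> T2) (psi : T2 -> T1) : Prop :=
  [/\ 0 < c, scales_measure mu nu c phi, measurable_fun setT psi,
      cancel phi psi & cancel psi phi].

Lemma measurable_preimage d1 d2 (T1 : measurableType d1)
    (T2 : measurableType d2) (phi : T1 -> T2) A :
  measurable_fun setT phi -> measurable A -> measurable (phi @^-1` A).
Proof. by move=> mphi mA; rewrite -(setTI (_ @^-1` _)); exact: mphi. Qed.

Section Transport.
Context d1 d2 (T1 : measurableType d1) (T2 : measurableType d2).
Variables (mu : {measure set T1 -> \bar R}) (nu : {measure set T2 -> \bar R}).

Lemma scaling_iso_sym c phi psi :
  scaling_iso mu nu c phi psi -> scaling_iso nu mu c^-1 psi phi.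
Proof.
move=> [c0 [mphi muE] mpsi phiK psiK]; split; rewrite ?invr_gt0//; split=> // A mA.
rewrite (_ : mu A = mu (phi @^-1` (psi @^-1` A))); last first.
  by congr (mu _); apply/seteqP; split=> x /=; rewrite phiK.
rewrite muE ?muleA; last exact: measurable_preimage.
by rewrite -EFinM mulVf ?mul1e// gt_eqF.
Qed.

Lemma ge0_integral_scales c phi D (f : T2 -> \bar R) : 0 <= c ->
  scales_measure mu nu c phi -> measurable D -> measurable_fun D f ->
  (forall x, D x -> 0 <= f x)%E ->
  (\int[mu]_(x in phi @^-1` D) f (phi x) = c%:E * \int[nu]_(x in D) f x)%E.
Proof.
move=> c0 [mphi muE] mD mf f0.
rewrite -(@ge0_integral_pushforward _ _ _ _ _ _ mphi mu D f)//; last first.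
  by move=> y; rewrite inE; exact: f0.
rewrite -[c]/((NngNum c0)%:num) -ge0_integral_mscale//.
pose mphi_mixin := isMeasurableFun.Build _ _ _ _ _ mphi.
pose mphi_pack : {mfun _ >-> _} := HB.pack phi mphi_mixin.
rewrite -[phi]/(mphi_pack : _ -> _).
by apply: eq_measure_integral => A mA _ /=; exact: muE.
Qed.

Lemma scales_ae c phi (P : T2 -> Prop) : scales_measure mu nu c phi ->
  {ae nu, forall x, P x} -> {ae mu, forall x, P (phi x)}.
Proof.
move=> [mphi muE] [N [mN N0 PN]]; exists (phi @^-1` N); split.
- exact: measurable_preimage.
- by rewrite muE// N0 mule0.
- by move=> x Px; exact: PN.
Qed.

Lemma integrable_scales c phi D (f : T2 -> \bar R) : 0 <= c ->
  scales_measure mu nu c phi -> measurable D ->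
  nu.-integrable D f -> mu.-integrable (phi @^-1` D) (f \o phi).
Proof.
move=> c0 sc mD /integrableP[mf iF]; have [mphi _] := sc; apply/integrableP; split.
  apply: (measurable_comp mD _ mf); last exact: measurable_funTS.
  by move=> _ [x Dx <-].
rewrite (@ge0_integral_scales c phi D (abse \o f) c0 sc mD)//.
  by rewrite lte_mul_pinfty ?lee_fin.
  exact: measurableT_comp.
by move=> x _; exact: abse_ge0.
Qed.

Lemma lebesgue_integrable_scales c phi D (f : T2 -> R) : 0 <= c ->
  scales_measure mu nu c phi -> measurable D ->
  lebesgue_integrable nu D f ->
  lebesgue_integrable mu (phi @^-1` D) (f \o phi).
Proof.
move=> c0 sc mD [g ig fg]; exists (g \o phi).
  exact: (integrable_scales c0 sc mD ig).
exact: (scales_ae sc fg).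
Qed.

Lemma Rintegral_scales c phi D (f : T2 -> R) : 0 <= c ->
  scales_measure mu nu c phi -> measurable D ->
  lebesgue_integrable nu D f ->
  \int[mu]_(x in phi @^-1` D) f (phi x) = c * \int[nu]_(x in D) f x.
Proof.
move=> c0 sc mD [g ig fg].
rewrite (Rintegral_ae fg) (Rintegral_ae (scales_ae sc fg)).
have mg := measurable_int _ ig.
rewrite /Rintegral integralE [in RHS]integralE.
have ip := integrable_funepos mD ig; have in_ := integrable_funeneg mD ig.
have hp := ge0_integral_scales c0 sc mD (measurable_int _ ip).
have hn := ge0_integral_scales c0 sc mD (measurable_int _ in_).
under eq_integral do rewrite (funepos_comp (EFin \o g) phi)/=.
under [X in (_ - X)%E]eq_integral do rewrite (funeneg_comp (EFin \o g) phi)/=.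
rewrite hp// hn//.
rewrite -muleBr//.
  rewrite fineM// fin_numB integrable_fin_num//; exact: integrable_fin_num.
by apply: fin_num_adde_defl; rewrite fin_numN; exact: integrable_fin_num.
Qed.

End Transport.

Lemma scales_measure_comp d1 d2 d3 (T1 : measurableType d1)
    (T2 : measurableType d2) (T3 : measurableType d3)
    (mu : {measure set T1 -> \bar R}) (nu : {measure set T2 -> \bar R})
    (rho : {measure set T3 -> \bar R}) c c' phi phi' :
  scales_measure mu nu c phi -> scales_measure nu rho c' phi' ->
  scales_measure mu rho (c * c') (phi' \o phi).
Proof.
move=> [mphi muE] [mphi' nuE]; split; first exact: measurableT_comp.
move=> A mA; rewrite comp_preimage muE ?nuE ?EFinM ?muleA//.
exact: measurable_preimage.
Qed.

Lemma scaling_iso_comp d1 d2 d3 (T1 : measurableType d1)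
    (T2 : measurableType d2) (T3 : measurableType d3)
    (mu : {measure set T1 -> \bar R}) (nu : {measure set T2 -> \bar R})
    (rho : {measure set T3 -> \bar R}) c c' phi phi' psi psi' :
  scaling_iso mu nu c phi psi -> scaling_iso nu rho c' phi' psi' ->
  scaling_iso mu rho (c * c') (phi' \o phi) (psi \o psi').
Proof.
move=> [c0 sc mpsi phiK psiK] [c0' sc' mpsi' phiK' psiK']; split.
- exact: mulr_gt0.
- exact: scales_measure_comp sc'.
- exact: measurableT_comp.
- exact: can_comp.
- exact: can_comp.
Qed.

Lemma lebesgue_integrable_iso d1 d2 (T1 : measurableType d1)
    (T2 : measurableType d2)
    (mu : {measure set T1 -> \bar R}) (nu : {measure set T2 -> \bar R})
    c phi psi D (f : T2 -> R) :
  scaling_iso mu nu c phi psi -> measurable D ->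
  lebesgue_integrable mu (phi @^-1` D) (f \o phi) <->
  lebesgue_integrable nu D f.
Proof.
move=> iso mD; have [c0 sc mpsi phiK psiK] := iso; split; last first.
  exact: lebesgue_integrable_scales (ltW c0) sc mD.
have [c0' sc' _ _ _] := scaling_iso_sym iso.
have mpD : measurable (phi @^-1` D) by apply: measurable_preimage => //; case: sc.
move=> /(lebesgue_integrable_scales (ltW c0') sc' mpD).
rewrite -comp_preimage -compA.
by rewrite (_ : phi \o psi = id)//; apply/funext => x /=; exact: psiK.
Qed.

End ScalingMaps.

(** * Fubini for functions of the first variable *)

Section Sections.
Context d1 d2 (T1 : measurableType d1) (T2 : measurableType d2) (R : realType).
Variable m1 : {sigma_finite_measure set T1 -> \bar R}.
Variable m2 : {sigma_finite_measure set T2 -> \bar R}.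

(** The measures of the sections of a null set integrate to zero, hence almost all of them
    vanish. *)
Lemma ae_xsection (P : T1 * T2 -> Prop) :
  {ae (m1 \x m2)%E, forall p, P p} ->
  {ae m1, forall u, {ae m2, forall y, P (u, y)}}.
Proof.
move=> [N [mN N0 PN]].
have mxN : measurable_fun setT (m2 \o xsection N) by exact: measurable_fun_xsection.
have : (\int[m1]_u `|(m2 \o xsection N) u| = 0)%E.
  by under eq_integral do rewrite gee0_abs//=.
move/(ae_eq_integral_abs m1 measurableT mxN); apply: filterS => u /(_ I) /= Nu.
exists (xsection N u); split => //; first exact: measurable_xsection.
by move=> y /= Py; apply/xsectionP; exact: PN.
Qed.

Variables (E : set (T1 * T2)) (mE : measurable E) (v : T1 -> R).
Hypothesis vE : forall u, m2 (xsection E u) = (v u)%:E.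

Let mv : measurable_fun setT v.
Proof.
apply/measurable_EFinP; rewrite (_ : _ \o _ = m2 \o xsection E).
  exact: measurable_fun_xsection.
by apply/funext => u /=; rewrite vE.
Qed.

Let integral_section u (c : R) :
  (\int[m2]_y (c * \1_E (u, y))%:E = (c * v u)%:E)%E.
Proof.
under eq_integral do rewrite EFinM.
rewrite (_ : (fun y => _) = fun y => c%:E * (\1_(xsection E u) y)%:E)%E; last first.
  by apply/funext => y; rewrite !indicE mem_xsection.
have mEu : measurable (xsection E u) by exact: measurable_xsection.
rewrite integralZl//.
  by rewrite integral_indic// setIT [X in (_ * X)%E]vE EFinM.
apply/integrableP; split; first exact/measurable_EFinP.
under eq_integral do rewrite gee0_abs ?lee_fin//.
by rewrite integral_indic// setIT [ltLHS]vE ltry.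
Qed.

(* For almost every [u] the values [h u] times the volume of the section are
   recovered by integrating over the section any measurable function that is
   almost everywhere equal to the cylindrical function; this makes the product
   [h * v] measurable up to a null set. *)
Lemma cylinder_integrable (h : T1 -> R) :
  lebesgue_integrable (m1 \x m2)%E E (h \o fst) ->
  lebesgue_integrable m1 setT (fun u => h u * v u) /\
  \int[(m1 \x m2)%E]_(p in E) h p.1 = \int[m1]_u (h u * v u).
Proof.
move=> [g ig hg].
pose gE := (EFin \o g) \_ E.
have igE : (m1 \x m2)%E.-integrable setT gE by exact/(integrable_mkcond _ mE).
pose G u := (\int[m2]_y gE (u, y))%E.
have iG : m1.-integrable setT G by exact: integrable_fubini_F igE.
have hG : {ae m1, forall u, (h u * v u)%:E = G u}.
  have := ae_xsection hg; apply: filterS => u hgu.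
  rewrite -integral_section; apply: integral_ae.
  apply: filterS hgu => y hgu _; rewrite /gE patchE indicE.
  case: ifPn => uyE /=; last by rewrite mulr0.
  by rewrite mulr1; congr EFin; apply: hgu; rewrite inE in uyE.
split.
  exists (fine \o G).
    apply/integrableP; split.
      apply/measurable_EFinP; apply: measurableT_comp => //.
      exact: measurable_int iG.
    have /integrableP[_] := iG; apply: le_lt_trans.
    apply: ge0_le_integral => //.
    - apply: measurableT_comp => //; apply/measurable_EFinP.
      by apply: measurableT_comp => //; exact: measurable_int iG.
    - by apply: measurableT_comp => //; exact: measurable_int iG.
    by move=> u _ /=; case: (G u) => [r ||] /=; rewrite ?normr0 ?leey.
  by apply: filterS hG => u /= <-.
rewrite (Rintegral_ae hg) /Rintegral; congr fine.
rewrite integral_mkcond -/gE -(integral12_prod_meas1 igE).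
by apply: integral_ae; apply: filterS hG => u.
Qed.

(** The measurable representative is the quotient [g / v], whose absolute value has integral over
    [E] at most that of [g] on the line. It may differ from [h] where [v] vanishes, but the part of
    [E] over such [u] is null because its sections have volume 0. *)
Lemma integrable_cylinder (h : T1 -> R) :
  lebesgue_integrable m1 setT (fun u => h u * v u) ->
  lebesgue_integrable (m1 \x m2)%E E (h \o fst).
Proof.
move=> [g ig hg].
have mg : measurable_fun setT g by apply/measurable_EFinP; exact: measurable_int ig.
pose q u := g u / v u.
have v_ge0 u : 0 <= v u by rewrite -lee_fin -vE.
have mq : measurable_fun setT q.
  (* The power with exponent -1 is measurable, and it agrees with the inverse also at 0, where both
     are 0. *)
  rewrite (_ : q = fun u => g u * v u `^ (-1)); last first.
    by apply/funext => u; rewrite powR_inv1.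
  apply: measurable_funM => //.
  exact: (measurableT_comp (measurable_powR _) mv).
have mqf : measurable_fun setT (q \o @fst T1 T2).
  exact: (measurableT_comp mq measurable_fst).
exists (q \o fst).
  apply/(integrable_mkcond _ mE).
  have mqE : measurable_fun setT ((EFin \o (q \o fst)) \_ E).
    apply/(measurable_restrictT _ mE); apply/measurable_EFinP.
    exact: measurable_funTS.
  apply/integrable12ltyP; first exact: mqE.
  have /integrableP[_] := ig; apply: le_lt_trans.
  apply: ge0_le_integral => //.
  - by move=> u _; exact: integral_ge0.
  - apply: (measurable_fun_fubini_tonelli_F
      (abse \o (EFin \o (q \o fst)) \_ E)) => /=.
      by apply: measurableT_comp => //; exact: mqE.
    by move=> x; exact: abse_ge0.
  - by apply: measurableT_comp => //; exact/measurable_EFinP.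
  move=> u _.
  under eq_integral => y _.
    rewrite (_ : `|_|%E = (`|q u| * \1_E (u, y))%:E); last first.
      rewrite patchE indicE; case: ifPn => _ /=; first by rewrite mulr1.
      by rewrite mulr0 normr0.
    over.
  rewrite integral_section lee_fin /q normrM normfV.
  have [->|vu] := eqVneq (v u) 0; first by rewrite mulr0.
  by rewrite (ger0_norm (v_ge0 u)) divfK.
have mv0 : measurable (v @^-1` [set 0]) by exact: measurable_preimage.
have [N [mN N0 hgN]] := hg.
have mZ : measurable (E `&` (v @^-1` [set 0]) `*` setT).
  by apply: measurableI => //; exact: measurableX.
exists (N `*` setT `|` E `&` (v @^-1` [set 0]) `*` setT); split.
- by apply: measurableU => //; exact: measurableX.
- apply: null_set_setU => //.
  + exact: measurableX.
  + by rewrite [LHS]product_measure1E// N0 mul0e.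
  + apply: integral0_eq => u _ /=.
    have [vu|vu] := eqVneq (v u) 0; last first.
      rewrite (_ : xsection _ _ = set0) ?measure0//; apply/seteqP; split => y //.
      by move=> /xsectionP[_ [/= /eqP]]; rewrite (negPf vu).
    apply: (subset_measure0 _ _ (_ : _ `<=` xsection E u)).
    * exact: measurable_xsection.
    * exact: measurable_xsection.
    * by move=> y /xsectionP[? _]; exact/xsectionP.
    * by rewrite [LHS]vE vu.
- move=> [u y] /= hq; have [vu|vu] := eqVneq (v u) 0.
    right; split => //; apply: contrapT => nE; apply: hq => uyE.
    by case: nE.
  left; split => //; apply: hgN => /= hgu; apply: hq => _.
  by rewrite /q -hgu// mulfK.
Qed.

End Sections.

Lemma tnth_behead_lift T n (t : n.+1.-tuple T) i :
  tnth [tuple of behead t] i = tnth t (lift ord0 i).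
Proof. by rewrite [in RHS](tuple_eta t) tnthS. Qed.

(** * Maps of a product that move one factor *)

Section SkewProducts.
Context d1 d2 (T1 : measurableType d1) (T2 : measurableType d2) (R : realType).
Variable m1 : {sigma_finite_measure set T1 -> \bar R}.
Variable m2 : {sigma_finite_measure set T2 -> \bar R}.

(** The product measure is defined by the other order of sections; Tonelli for the indicator of [A]
    exchanges them. *)
Lemma product_measure1_ysection A : measurable A ->
  ((m1 \x m2) A = \int[m2]_y m1 (ysection A y))%E.
Proof.
move=> mA; have := indic_fubini_tonelli m1 m2 mA.
by rewrite indic_fubini_tonelli_FE// indic_fubini_tonelli_GE.
Qed.

(** The section over [x] of the preimage of [A] is the preimage under [tau x] of the section of [A],
    so its measure is [c] times that of the latter; it remains to integrate over [x]. *)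
Lemma scales_skew_r (tau : T1 -> T2 -> T2) c : 0 <= c ->
  measurable_fun setT (fun p : T1 * T2 => tau p.1 p.2) ->
  (forall x, scales_measure m2 m2 c (tau x)) ->
  scales_measure (m1 \x m2)%E (m1 \x m2)%E c (fun p => (p.1, tau p.1 p.2)).
Proof.
move=> c0 mtau sc; split; first exact/measurable_fun_pair.
move=> A mA; rewrite /= /product_measure1 -ge0_integralZl//.
- apply: eq_integral => x _ /=; have [_ <-] := sc x.
    by congr (m2 _); apply/seteqP; split => y; rewrite /xsection /= !inE.
  exact: measurable_xsection.
- exact: measurable_fun_xsection.
Qed.

Lemma scales_skew_l (sigma : T2 -> T1 -> T1) c : 0 <= c ->
  measurable_fun setT (fun p : T1 * T2 => sigma p.2 p.1) ->
  (forall y, scales_measure m1 m1 c (sigma y)) ->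
  scales_measure (m1 \x m2)%E (m1 \x m2)%E c (fun p => (sigma p.2 p.1, p.2)).
Proof.
move=> c0 msigma sc; have mphi : measurable_fun setT
    (fun p : T1 * T2 => (sigma p.2 p.1, p.2)) by exact/measurable_fun_pair.
split => // A mA; rewrite [LHS]product_measure1_ysection; last first.
  exact: measurable_preimage.
rewrite [X in (_ * X)%E]product_measure1_ysection// -ge0_integralZl//.
- apply: eq_integral => y _; have [_ <-] := sc y.
    by congr (m1 _); apply/seteqP; split => x; rewrite /ysection /= !inE.
  exact: measurable_ysection.
- exact: measurable_fun_ysection.
Qed.

End SkewProducts.

(** * Lebesgue measure under dilations and translations *)

Section LebesgueAffine.
Variable R : realType.
Local Notation RT := (measurableTypeR R).
Local Notation lambda := (@lebesgue_measure R).

(** Lebesgue measure is determined by its values on half-open intervals, so it suffices that [a]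
    times the pushforward gives them their length. *)
Lemma scales_lebesgue_affine (a c : R) : 0 < a ->
  scales_measure lambda lambda a^-1 (fun x : RT => a * x + c : RT).
Proof.
move=> a0; have mphi : measurable_fun setT (fun x : RT => a * x + c : RT).
  by apply: measurable_funD => //; apply: measurable_funM.
split=> // A mA.
pose mphi_mixin := isMeasurableFun.Build _ _ _ _ _ mphi.
pose phi : {mfun RT >-> RT} := HB.pack (fun x : RT => a * x + c : RT) mphi_mixin.
have a0' : 0 <= a by exact: ltW.
rewrite [X in (_ * X)%E](@lebesgue_measure_unique _ (mscale (NngNum a0') (pushforward lambda phi)))//.
  by rewrite /mscale/= /pushforward muleA -EFinM mulVf ?gt_eqF// mul1e.
move=> _ [[x y]] _ <-; 
rewrite [RHS]/(a%:E * lambda (phi @^-1` `]x, y]))%E.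
rewrite (_ : phi @^-1` _ = `](x - c) / a, (y - c) / a]%classic); last first.
  apply/seteqP; split => z /=; rewrite !in_itv/= ltr_pdivrMr// ler_pdivlMr//;
    by rewrite ltrBlDr lerBrDr mulrC.
rewrite !lebesgue_measure_itv/= !lte_fin ltr_pM2r ?invr_gt0// ltrD2r.
case: ifPn => _ /=; last by rewrite mulr0.
by congr EFin; field; rewrite gt_eqF.
Qed.

Lemma scales_lebesgue_opp :
  scales_measure lambda lambda 1 (fun x : RT => - x : RT).
Proof.
split; first exact: oppr_measurable.
by move=> A mA; rewrite mul1e; exact: lebesgue_measureN.
Qed.

Lemma scales_cons_pair n :
  scales_measure (lambda \x lebesgue_tuple R n)%E (lebesgue_tuple R n.+1) 1
    (@cons_pair R n).
Proof. by split; [exact: measurable_cons_pair | move=> A mA; rewrite mul1e]. Qed.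

Definition uncons_pair n (y : n.+1.-tuple RT) : RT * n.-tuple RT :=
  (thead y, [tuple of behead y]).

Lemma uncons_pairK n : cancel (@uncons_pair n) (@cons_pair R n).
Proof. by move=> y; rewrite [RHS]tuple_eta; exact/val_inj. Qed.

Lemma cons_pairK n : cancel (@cons_pair R n) (@uncons_pair n).
Proof. by move=> [s x]; congr pair; exact/val_inj. Qed.

Lemma cons_pair_iso n :
  scaling_iso (lambda \x lebesgue_tuple R n)%E (lebesgue_tuple R n.+1) 1
    (@cons_pair R n) (@uncons_pair n).
Proof.
split=> //; [exact: scales_cons_pair| |exact: cons_pairK|exact: uncons_pairK].
apply/measurable_fun_pair; last exact: measurable_behead.
exact: (measurable_tnth ord0).
Qed.

Lemma uncons_pair_iso n :
  scaling_iso (lebesgue_tuple R n.+1) (lambda \x lebesgue_tuple R n)%E 1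
    (@uncons_pair n) (@cons_pair R n).
Proof. by have := scaling_iso_sym (cons_pair_iso n); rewrite invr1. Qed.

Definition tuple_affine n (rho : R) (v x : n.-tuple RT) : n.-tuple RT :=
  [tuple rho * tnth x i + tnth v i | i < n].

Lemma scales_tuple_affine n rho (v : n.-tuple RT) : 0 < rho ->
  scales_measure (lebesgue_tuple R n) (lebesgue_tuple R n) (rho ^- n)
    (tuple_affine rho v).
Proof.
move=> rho0; elim: n v => [|n IH] v.
  have idE : tuple_affine rho v = id.
    by apply/funext => x; rewrite [LHS]tuple0 [RHS]tuple0.
  by rewrite idE; split => // A mA; rewrite expr0 invr1 mul1e.
pose r0 := uncons_pair v.
have lc (y : n.-tuple RT) := scales_lebesgue_affine r0.1 rho0.
have mr := (IH r0.2).1.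
have ri : 0 <= rho^-1 by rewrite invr_ge0 ltW.
have rni : 0 <= rho ^- n by rewrite invr_ge0 exprn_ge0// ltW.
(* Detach the head, move it, move the tail, reattach: the constants multiply to [rho^-1 * rho ^- n].
   The head moves in the same way for every tail, so [nseq_tuple n 0] is only a sample tail. *)
have := scales_measure_comp (scales_measure_comp (scales_measure_comp
  (let: And5 _ s _ _ _ := uncons_pair_iso n in s)
  (scales_skew_l (lebesgue_tuple R n) ri
     (measurableT_comp (lc (nseq_tuple n 0)).1 measurable_fst) lc))
  (scales_skew_r lambda rni
     (measurableT_comp mr measurable_snd) (fun=> IH r0.2)))
  (scales_cons_pair n).
rewrite mul1r mulr1 -invfM -exprS.
congr (scales_measure _ _ _ _); apply/funext => x; apply: eq_from_tnth => i.
rewrite /= tnth_mktuple; case: (unliftP ord0 i) => [j ->|-> //].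
by rewrite !tnthS !tnth_mktuple !tnth_behead_lift.
Qed.

End LebesgueAffine.

(** * Shears and rotations *)

Section Rotation.
Variable R : realType.
Local Notation RT := (measurableTypeR R).
Local Notation lambda := (@lebesgue_measure R).
Local Notation prodL n := (lambda \x lebesgue_tuple R n)%E.

Definition dott n (x y : n.-tuple RT) : R := \sum_(i < n) tnth x i * tnth y i.

Lemma dott_cons n (x y : n.+1.-tuple RT) :
  dott x y = thead x * thead y +
    dott [tuple of behead x] [tuple of behead y].
Proof.
rewrite /dott big_ord_recl; congr (_ + _).
by apply: eq_bigr => i _; rewrite !tnth_behead_lift.
Qed.

Lemma dott_ge0 n (x : n.-tuple RT) : 0 <= dott x x.
Proof. by apply: sumr_ge0 => i _; rewrite -expr2 sqr_ge0. Qed.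

Lemma measurable_dott n (w : n.-tuple RT) : measurable_fun setT (dott w).
Proof.
apply: measurable_sum => i; apply: measurable_funM => //.
exact: measurable_tnth.
Qed.

Lemma measurable_dott_sq n : measurable_fun setT (fun x : n.-tuple RT => dott x x).
Proof.
by apply: measurable_sum => i; apply: measurable_funM; exact: measurable_tnth.
Qed.

Definition shear_l n (a : R) (w : n.-tuple RT) (p : RT * n.-tuple RT) :
    RT * n.-tuple RT :=
  (p.1 + a * dott w p.2, p.2).

Definition shear_r n (a : R) (w : n.-tuple RT) (p : RT * n.-tuple RT) :
    RT * n.-tuple RT :=
  (p.1, [tuple tnth p.2 i + a * p.1 * tnth w i | i < n]).

Lemma scales_shear_l n a (w : n.-tuple RT) :
  scales_measure (prodL n) (prodL n) 1 (shear_l a w).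
Proof.
apply: (@scales_skew_l _ _ _ _ _ _ _
  (fun (x : n.-tuple RT) (s : RT) => s + a * dott w x : RT)) => //.
  apply: measurable_funD; first exact: measurable_fst.
  apply: measurable_funM => //.
  exact: (measurableT_comp (measurable_dott w) measurable_snd).
move=> x; have := scales_lebesgue_affine (a * dott w x) (@ltr01 R).
by rewrite invr1; congr scales_measure; apply/funext => s; rewrite mul1r.
Qed.

Lemma scales_shear_r n a (w : n.-tuple RT) :
  scales_measure (prodL n) (prodL n) 1 (shear_r a w).
Proof.
apply: (@scales_skew_r _ _ _ _ _ _ _
  (fun (s : RT) (x : n.-tuple RT) =>
     [tuple tnth x i + a * s * tnth w i | i < n] : n.-tuple RT)) => //.
  apply/measurable_fun_tnthP => i.
  rewrite (_ : _ \o _ = fun p : RT * n.-tuple RT =>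
      tnth p.2 i + a * p.1 * tnth w i); last first.
    by apply/funext => p /=; rewrite tnth_mktuple.
  apply: measurable_funD.
    exact: (measurableT_comp (measurable_tnth i) measurable_snd).
  apply: measurable_funM => //; apply: measurable_funM => //.
move=> s; have := scales_tuple_affine [tuple a * s * tnth w i | i < n] (@ltr01 R).
rewrite expr1n invr1; congr scales_measure; apply/funext => x.
by apply: eq_from_tnth => i; rewrite !tnth_mktuple mul1r.
Qed.

Lemma shear_l_iso n a (w : n.-tuple RT) :
  scaling_iso (prodL n) (prodL n) 1 (shear_l a w) (shear_l (- a) w).
Proof.
split => //; first exact: scales_shear_l.
- by have [] := scales_shear_l (- a) w.
- by move=> [s x]; rewrite /shear_l /= mulNr addrK.
- by move=> [s x]; rewrite /shear_l /= mulNr subrK.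
Qed.

Lemma shear_r_iso n a (w : n.-tuple RT) :
  scaling_iso (prodL n) (prodL n) 1 (shear_r a w) (shear_r (- a) w).
Proof.
split => //; first exact: scales_shear_r.
- by have [] := scales_shear_r (- a) w.
- move=> [s x]; rewrite /shear_r /=; congr pair; apply: eq_from_tnth => i.
  by rewrite !tnth_mktuple !mulNr addrK.
- move=> [s x]; rewrite /shear_r /=; congr pair; apply: eq_from_tnth => i.
  by rewrite !tnth_mktuple !mulNr subrK.
Qed.

Lemma fst_affine_iso n a c : 0 < a ->
  scaling_iso (prodL n) (prodL n) a^-1
    (fun p : RT * n.-tuple RT => (a * p.1 + c : RT, p.2))
    (fun p : RT * n.-tuple RT => (a^-1 * p.1 - a^-1 * c : RT, p.2)).
Proof.
move=> a0; have an0 : a != 0 by rewrite gt_eqF.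
have sc (b e : R) : 0 < b -> scales_measure (prodL n) (prodL n) b^-1
    (fun p : RT * n.-tuple RT => (b * p.1 + e : RT, p.2)).
  move=> b0; apply: (@scales_skew_l _ _ _ _ _ _ _
    (fun (x : n.-tuple RT) (s : RT) => b * s + e : RT)).
  - by rewrite invr_ge0 ltW.
  - by apply: measurable_funD => //; apply: measurable_funM.
  - by move=> x; exact: scales_lebesgue_affine.
split.
- by rewrite invr_gt0.
- exact: sc.
- by case: (sc a^-1 (- (a^-1 * c))); rewrite ?invr_gt0.
- by move=> [s x] /=; congr pair; field.
- by move=> [s x] /=; congr pair; field.
Qed.

(** Replaces the three shears at [w0 = -1], where their slope is infinite; there [w = 0], and
    flipping the first axis is enough. *)
Lemma fst_opp_iso n :
  scaling_iso (prodL n) (prodL n) 1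
    (fun p : RT * n.-tuple RT => (- p.1 : RT, p.2))
    (fun p : RT * n.-tuple RT => (- p.1 : RT, p.2)).
Proof.
have sc : scales_measure (prodL n) (prodL n) 1
    (fun p : RT * n.-tuple RT => (- p.1 : RT, p.2)).
  apply: (@scales_skew_l _ _ _ _ _ _ _
    (fun (x : n.-tuple RT) (s : RT) => - s : RT)) => //.
    by apply: measurableT_comp => //; exact: measurable_fst.
  by move=> x; exact: scales_lebesgue_opp.
split => //; first by case: sc.
- by move=> [s x] /=; rewrite opprK.
- by move=> [s x] /=; rewrite opprK.
Qed.

Lemma dott_shear n (u w x : n.-tuple RT) (c : R) :
  dott u [tuple tnth x i + c * tnth w i | i < n] = dott u x + c * dott u w.
Proof.
rewrite /dott mulr_sumr -big_split; apply: eq_bigr => i _ /=.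
by rewrite tnth_mktuple mulrDr mulrCA.
Qed.

Lemma dottC n (x y : n.-tuple RT) : dott x y = dott y x.
Proof. by apply: eq_bigr => i _; rewrite mulrC. Qed.

(* A rotation of the plane spanned by the first axis and [w] is a product of
   three shears: for the angle [t] with [cos t = w0] the outer ones have slope
   [tan (t / 2) = sin t / (1 + cos t)]. *)
Lemma rotation_iso n (w0 : R) (w : n.-tuple RT) : w0 ^+ 2 + dott w w = 1 ->
  exists phi psi, scaling_iso (prodL n) (prodL n) 1 phi psi /\
    forall p, (phi p).1 = w0 * p.1 + dott w p.2 :> R /\
      (phi p).1 ^+ 2 + dott (phi p).2 (phi p).2 = p.1 ^+ 2 + dott p.2 p.2.
Proof.
move=> w1; have ww : dott w w = 1 - w0 ^+ 2 by rewrite -w1 addrC addKr.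
have [w0N|w0N] := eqVneq (1 + w0) 0.
  have {}w0N : w0 = -1 by apply/eqP; rewrite -subr_eq0 opprK addrC w0N.
  exists (fun p : RT * n.-tuple RT => (- p.1 : RT, p.2)), (fun p => (- p.1 : RT, p.2)).
  split; first exact: fst_opp_iso.
  move=> [s x] /=; split; last by rewrite sqrrN.
  have w_0 i : tnth w i = 0.
    apply/eqP; rewrite -sqrf_eq0 expr2; apply/eqP.
    move: ww; rewrite w0N sqrrN expr1n subrr => /psumr_eq0P -> // j _.
    by rewrite -expr2 sqr_ge0.
  by rewrite /dott big1 ?addr0 ?w0N ?mulN1r// => i _; rewrite w_0 mul0r.
(* As [w] has norm [sin t], the outer shears, along [l] times [w], have slope [tan (t / 2)], and the
   middle one, along [- w], has slope [- sin t]. *)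
pose l := (1 + w0)^-1.
have l0 : l != 0 by rewrite invr_eq0.
have iso := scaling_iso_comp (scaling_iso_comp (shear_l_iso l w)
  (shear_r_iso (-1) w)) (shear_l_iso l w).
rewrite !mulr1 in iso; do 2 eexists; split; first exact: iso.
have w0E : w0 = l^-1 - 1 by rewrite invrK addrC addKr.
move=> [s x] /=; rewrite !dott_shear [dott [tuple _ | _ < _] _]dottC !dott_shear.
rewrite [dott [tuple _ | _ < _] _]dottC !dott_shear (dottC x w) ww w0E.
move: (dott w x) (dott x x) => q r; clearbody l.
by split; field.
Qed.

End Rotation.

(** * Volume of the unit ball *)

Section BallVolume.
Variable R : realType.
Local Notation RT := (measurableTypeR R).
Local Notation lambda := (@lebesgue_measure R).

(** Indexed by the squared radius: the ball is empty for [t <= 0], and the Gaussian layers and the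
    sections met below are such balls without any square root. *)
Definition tuple_ball n (t : R) : set (n.-tuple RT) := [set x | dott x x < t].

Lemma measurable_tuple_ball n t : measurable (@tuple_ball n t).
Proof.
rewrite (_ : tuple_ball t = (fun x : n.-tuple RT => dott x x) @^-1` `]-oo, t[).
  by apply: measurable_preimage => //; exact: measurable_dott_sq.
by apply/seteqP; split => x /=; rewrite in_itv.
Qed.

Lemma tuple_ball_le0 n t : t <= 0 -> @tuple_ball n t = set0.
Proof.
move=> t0; apply/seteqP; split => // x; rewrite /tuple_ball/= => xt.
by have := lt_le_trans xt t0; rewrite ltNge dott_ge0.
Qed.

(** Dilation by [t ^ (-1/2)] takes this ball to the unit ball. The identity is one of extended
    reals, as the volume is not yet known to be finite. *)
Lemma lebesgue_tuple_ball n t : 0 < t ->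
  lebesgue_tuple R n (tuple_ball t) =
  ((t `^ (n%:R / 2))%:E * lebesgue_tuple R n (tuple_ball 1))%E.
Proof.
move=> t0; have st0 : 0 < Num.sqrt t by rewrite sqrtr_gt0.
have rho0 : 0 < (Num.sqrt t)^-1 by rewrite invr_gt0.
have [_ sc] := scales_tuple_affine [tuple 0 | i < n] rho0.
have := sc _ (measurable_tuple_ball 1).
rewrite (_ : _ @^-1` _ = tuple_ball t) => [->|].
  congr (_%:E * _)%E; rewrite exprVn invrK -powR12_sqrt ?ltW//.
  by rewrite -powR_mulrn ?powR_ge0// -powRrM mulrC.
apply/seteqP; split => x; rewrite /tuple_ball/=.
all: have -> : dott (tuple_affine (Num.sqrt t)^-1 [tuple 0 | _ < n] x)
       (tuple_affine (Num.sqrt t)^-1 [tuple 0 | _ < n] x) = dott x x / t.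
all: try by rewrite ltr_pdivrMr ?mul1r.
all: rewrite /dott mulr_suml; apply: eq_bigr => i _; rewrite !tnth_mktuple !addr0.
all: rewrite -[in RHS](sqr_sqrtr (ltW t0)) mulrACA [RHS]mulrC expr2 invfM.
all: by [].
Qed.

(** The integrand is a product over the coordinates: by Tonelli each of them contributes a
    one-dimensional Gaussian integral. *)
Lemma integral_gauss_tuple n :
  (\int[lebesgue_tuple R n]_x (expR (- dott x x))%:E =
   (Num.sqrt pi ^+ n)%:E)%E.
Proof.
have mexp k : measurable_fun setT (fun x : k.-tuple RT => (expR (- dott x x))%:E).
  apply/measurable_EFinP; apply: measurableT_comp => //.
  by apply: measurableT_comp => //; exact: measurable_dott_sq.
elim: n => [|n IH].
  rewrite (eq_integral (cst 1%E)); last first.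
    by move=> x _; rewrite /dott big_ord0 oppr0 expR0.
  by rewrite integral_cst// mul1e /= diracT.
have := ge0_integral_scales (@ler01 R) (scales_cons_pair R n) measurableT (mexp _)
  (fun x _ => expR_ge0 _).
rewrite mul1e => <-; rewrite preimage_setT.
have E (p : RT * n.-tuple RT) : (expR (- dott (cons_pair p) (cons_pair p)))%:E =
    ((expR (- p.1 ^+ 2))%:E * (expR (- dott p.2 p.2))%:E)%E.
  rewrite -EFinM -expRD dott_cons opprD -expr2; congr (expR (- _ ^+ 2 + - _))%:E.
  by congr dott; exact: val_inj.
rewrite fubini_tonelli1/=; last 2 first.
- exact: (measurableT_comp (mexp _) (@measurable_cons_pair R n)).
- by move=> p; rewrite lee_fin expR_ge0.
transitivity (\int[lambda]_s ((Num.sqrt pi ^+ n)%:E * (gauss_fun s)%:E))%E.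
  apply: eq_integral => s _; rewrite /fubini_F.
  rewrite (eq_integral (fun x => (gauss_fun s)%:E * (expR (- dott x x))%:E)%E).
    rewrite ge0_integralZl_EFin ?gauss_fun_ge0//; first by rewrite [X in (_ * X)%E]IH muleC.
    exact: mexp.
  by move=> x _; rewrite E.
rewrite ge0_integralZl//=.
- rewrite exprSr EFinM; congr (_ * _)%E; exact: integralT_gauss.
- by apply/measurable_EFinP; exact: measurable_gauss_fun.
- by move=> x _; rewrite lee_fin gauss_fun_ge0.
Qed.

(** Translation by [q] takes out the factor [expR (- q)] and leaves the total mass of the
    exponential density of rate 1. *)
Lemma integral_expRN_gt (q : R) :
  (\int[lambda]_(t in `]q, +oo[) (expR (- t))%:E = (expR (- q))%:E)%E.
Proof.
have mexp : measurable_fun setT (fun t : R => (expR (- t))%:E).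
  by apply/measurable_EFinP; apply: measurableT_comp.
have sc := scales_lebesgue_affine q (@ltr01 R).
have c0 : 0 <= 1^-1 :> R by rewrite invr1.
have := ge0_integral_scales c0 sc (measurable_itv `]q, +oo[)
  (measurable_funTS mexp) (fun x _ => expR_ge0 _).
rewrite invr1 mul1e => <-.
rewrite (_ : _ @^-1` _ = `]0, +oo[%classic); last first.
  by apply/seteqP; split => s /=; rewrite !in_itv/= !andbT mul1r ltrDr.
rewrite (eq_integral (fun s : RT => (expR (- q))%:E * (expR (- s : R))%:E)%E); last first.
  by move=> s _; rewrite mul1r addrC opprD expRD EFinM.
rewrite ge0_integralZl_EFin ?expR_ge0//; last first.
  exact: measurable_funTS.
rewrite -[RHS]mule1; congr (_ * _)%E; rewrite -(integral_exponential_pdf ltr01).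
rewrite integral_itv_obnd_cbnd; last exact: measurable_funTS.
rewrite integral_mkcond; apply: eq_integral => s _.
rewrite /exponential_pdf !patchE; case: ifPn => // _.
by rewrite mul1r mulN1r.
Qed.

(* Layer cake: [expR (- dott x x)] is the integral of [expR (- t)] over
   [t > dott x x]. *)
Lemma gauss_layer_cake n :
  ((Num.sqrt pi ^+ n)%:E = lebesgue_tuple R n (tuple_ball 1) *
    \int[lambda]_(t in `]0%R, +oo[) (t `^ (n%:R / 2) * expR (- t))%:E)%E.
Proof.
pose A := [set p : n.-tuple RT * RT | dott p.1 p.1 < p.2].
have mA : measurable A.
  rewrite (_ : A = (fun p : n.-tuple RT * RT => p.2 - dott p.1 p.1) @^-1` `]0, +oo[).
    apply: measurable_preimage => //; apply: measurable_funB => //.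
    exact: (measurableT_comp (@measurable_dott_sq R n) measurable_fst).
  by apply/seteqP; split => p /=; rewrite in_itv/= andbT subr_gt0.
have mexp : measurable_fun setT (fun t : RT => (expR (- t : R))%:E).
  by apply/measurable_EFinP; apply: measurableT_comp.
pose F (p : n.-tuple RT * RT) := ((expR (- p.2 : R))%:E * (\1_A p)%:E)%E.
have mF : measurable_fun setT F.
  apply: emeasurable_funM; first exact: (measurableT_comp mexp measurable_snd).
  exact/measurable_EFinP.
have F0 p : (0 <= F p)%E by rewrite /F -EFinM lee_fin mulr_ge0 ?expR_ge0.
(* For fixed [x] the inner integral is [expR (- dott x x)]; in the other order it is [expR (- t)]
   times the volume of the ball of squared radius [t]. *)
have := fubini_tonelli (m1 := lebesgue_tuple R n) (m2 := lambda) F mF F0.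
rewrite (eq_integral (fun x => (expR (- dott x x))%:E)); last first.
  move=> x _; rewrite -integral_expRN_gt [RHS]integral_mkcond.
  apply: eq_integral => t _; rewrite patchE /F indicE /=.
  have -> : ((x, t) \in A) = (t \in `]dott x x, +oo[%classic).
    by apply/idP/idP; rewrite !inE /A /= in_itv/= andbT.
  by case: ifPn => _; rewrite ?mule1 ?mule0.
rewrite integral_gauss_tuple => ->.
rewrite -ge0_integralZl//; last 2 first.
- apply/measurable_EFinP; apply: measurable_funM.
    by apply: measurable_funTS; exact: measurable_powR.
  by apply: measurable_funTS; apply: measurableT_comp.
- by move=> t _; rewrite lee_fin mulr_ge0 ?powR_ge0 ?expR_ge0.
rewrite [RHS]integral_mkcond; apply: eq_integral => t _; rewrite patchE.
rewrite (eq_integral (fun x : n.-tuple RT =>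
    (expR (- t : R))%:E * (\1_(tuple_ball t) x)%:E)%E); last first.
  by move=> x _; rewrite /F !indicE.
rewrite ge0_integralZl_EFin ?expR_ge0//; last first.
  apply/measurable_EFinP/measurable_indic; exact: measurable_tuple_ball.
rewrite integral_indic ?setIT//; last exact: measurable_tuple_ball.
case: ifPn => [|/negP]; rewrite inE/= in_itv/= andbT.
  by move=> t0; rewrite lebesgue_tuple_ball// EFinM muleA muleC [(_ * (_)%:E)%E]muleC.
by move/negP; rewrite -leNgt => t0; rewrite (tuple_ball_le0 n)// measure0 mule0.
Qed.

(** In the layer cake identity the left side is finite and positive, so neither factor on the right
    can be zero or infinite: the volume is finite and [Gamma], the [fine] part of the integral, is
    nonzero. The argument is written for dimension [n = k - 1], where [(k + 1) / 2 = n / 2 + 1]. *)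
Lemma ball_volume n :
  Gamma ((n.+1%:R + 1) / 2 : R) != 0 /\
  lebesgue_tuple R n (tuple_ball 1) =
  (pi `^ (n%:R / 2) / Gamma ((n.+1%:R + 1) / 2 : R))%:E.
Proof.
have := gauss_layer_cake n.
have -> : Num.sqrt pi ^+ n = pi `^ (n%:R / 2) :> R.
  by rewrite -powR12_sqrt ?pi_ge0// -powR_mulrn ?powR_ge0// -powRrM mulrC.
have p0 : 0 < pi `^ (n%:R / 2) :> R by rewrite powR_gt0// pi_gt0.
have -> : Gamma ((n.+1%:R + 1) / 2 : R) =
    fine (\int[lambda]_(t in `]0%R, +oo[) (t `^ (n%:R / 2) * expR (- t))%:E)%E.
  rewrite /Gamma /Rintegral; congr fine; apply: eq_integral => t _ /=.
  by congr ((_ `^ _ * _)%:E); rewrite -natr1; field.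
have I0 : (0 <= \int[lambda]_(t in `]0%R, +oo[) (t `^ (n%:R / 2) * expR (- t))%:E)%E.
  by apply: integral_ge0 => t _; rewrite lee_fin mulr_ge0 ?powR_ge0 ?expR_ge0.
have V0 : (0 <= lebesgue_tuple R n (tuple_ball 1))%E by exact: measure_ge0.
move: p0; move: (pi `^ _) => p p0; move: I0 V0.
case: (integral _ _ _) => [I| |//]; case: (lebesgue_tuple _ _ _) => [V| |//] I0 V0.
- move=> [pVI]; have I_neq0 : I != 0.
    by apply: contraTneq p0 => I_0; rewrite pVI I_0 mulr0 ltxx.
  by split => //; congr EFin; rewrite /= pVI mulfK.
- rewrite le_eqVlt in I0; case/orP: I0 => [/eqP [<-]|I0].
    by rewrite mule0 => -[p_0]; rewrite p_0 ltxx in p0.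
  by rewrite gt0_mulye.
- rewrite le_eqVlt in V0; case/orP: V0 => [/eqP [<-]|V0].
    by rewrite mul0e => -[p_0]; rewrite p_0 ltxx in p0.
  by rewrite gt0_muley.
- by rewrite mulyy.
Qed.

End BallVolume.

(** * Reduction of a ridge function on the ball to an Abel integral *)

Section RidgeFunctions.
Variable R : realType.
Local Notation RT := (measurableTypeR R).
Local Notation lambda := (@lebesgue_measure R).
Local Notation prodL n := (lambda \x lebesgue_tuple R n)%E.

(** Only the final substitution [u = b * s + b] changes volume, whence [b^-1]. The rotation
    preserves the norm, so the tail keeps what the first coordinate [dott w y] leaves of
    [dott y y]. *)
Lemma ridge_iso n (w : n.+1.-tuple RT) b : dott w w = 1 -> 0 < b ->
  exists phi psi, scaling_iso (lebesgue_tuple R n.+1) (prodL n) b^-1 phi psi /\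
    forall y, (phi y).1 = b * dott w y + b :> R /\
      dott (phi y).2 (phi y).2 = dott y y - dott w y ^+ 2.
Proof.
move=> w1 b0; rewrite dott_cons -expr2 in w1.
have [phi [psi [iso phiE]]] := rotation_iso w1.
have := scaling_iso_comp (scaling_iso_comp (uncons_pair_iso R n) iso)
  (fst_affine_iso n b b0).
rewrite !mul1r => {}iso; do 2 eexists; split; first exact: iso.
move=> y /=; have [p1 p2] := phiE (uncons_pair y).
have dy : dott w y = (phi (uncons_pair y)).1 by rewrite p1 dott_cons.
split; first by rewrite dy.
apply/eqP; rewrite dy eq_sym subr_eq addrC p2 dott_cons; apply/eqP.
by rewrite expr2.
Qed.

Variables (n : nat) (b : R).
Hypothesis b_gt0 : 0 < b.
(** With [k = n.+1], [e] is the Abel exponent [(k - 1) / 2 = n / 2] and [V] is the volume of the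
    unit ball of dimension [n]. *)
Let e : R := (n.+1%:R - 1) / 2.
Let V : R := pi `^ e / Gamma ((n.+1%:R + 1) / 2).

(** The image of the unit ball under the map of [ridge_iso]: an ellipsoid centred at [(b, 0)] with
    half-axis [b] along [u]. *)
Definition cap : set (RT * n.-tuple RT) :=
  [set p | dott p.2 p.2 < 1 - ((p.1 - b) / b) ^+ 2].

Lemma measurable_cap : measurable cap.
Proof.
rewrite (_ : cap = (fun p : RT * n.-tuple RT =>
    1 - ((p.1 - b) / b) ^+ 2 - dott p.2 p.2) @^-1` `]0, +oo[); last first.
  by apply/seteqP; split => p /=; rewrite in_itv/= andbT subr_gt0.
apply: measurable_preimage => //; apply: measurable_funB.
  apply: measurable_funB => //; apply: measurable_funX.
  by apply: measurable_funM => //; apply: measurable_funB.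
exact: (measurableT_comp (@measurable_dott_sq R n) measurable_snd).
Qed.

Let v : R -> R :=
  (fun u => V * b ^- n * (u `^ e * (2 * b - u) `^ e)) \_ `]0, 2 * b[.

Lemma cap_section u : lebesgue_tuple R n (xsection cap u) = (v u)%:E.
Proof.
have b0 : b != 0 by rewrite gt_eqF.
have eE : e = n%:R / 2 by rewrite /e -natr1 addrK.
rewrite (_ : xsection _ _ = tuple_ball (1 - ((u - b) / b) ^+ 2)); last first.
  by apply/seteqP; split => x; rewrite /xsection /= inE.
(* In factored form the squared radius is positive exactly on []0, 2 * b[], and its power [e] splits
   into the two factors of the kernel and [b ^- n]. *)
have -> : 1 - ((u - b) / b) ^+ 2 = u * (2 * b - u) * b^-1 ^+ 2 by field.
rewrite /v patchE; case: ifPn => [|/negP]; rewrite inE/= in_itv/= => ub.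
  have /andP[u0 u2] := ub; have u2' : 0 < 2 * b - u by rewrite subr_gt0.
  have bi : 0 < b^-1 by rewrite invr_gt0.
  rewrite lebesgue_tuple_ball; last by rewrite !mulr_gt0 ?exprn_gt0.
  rewrite (ball_volume R n).2 -EFinM -eE; congr EFin.
  have bE : (b^-1 ^+ 2) `^ e = b ^- n.
    rewrite -(powR_mulrn 2 (ltW bi)) -powRrM eE mulrC divfK ?pnatr_eq0//.
    by rewrite powR_mulrn ?ltW// exprVn.
  have u0' := ltW u0; have u2'' := ltW u2'.
  rewrite powRM ?mulr_ge0 ?exprn_ge0 ?invr_ge0 ?(ltW b_gt0)// powRM// bE /V; ring.
rewrite tuple_ball_le0 ?measure0//.
rewrite mulr_le0_ge0 ?exprn_ge0 ?invr_ge0 ?(ltW b_gt0)//.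
move/negP: ub; rewrite negb_and -!leNgt => /orP[u0|u2].
  by rewrite mulr_le0_ge0// subr_ge0 (le_trans u0)// mulr_ge0// ltW.
by rewrite mulr_ge0_le0 ?subr_le0// (le_trans _ u2)// mulr_ge0// ltW.
Qed.

Variables (w : n.+1.-tuple RT) (f0 : R -> R).
Hypothesis w1 : dott w w = 1.

Let cylinderE :
  (fun u => f0 u * v u) =
  (fun u => V * b ^- n * F_integrand n.+1 f0 (2 * b) u) \_ `]0, 2 * b[.
Proof.
apply/funext => u; rewrite /v !patchE; case: ifPn => _; last by rewrite mulr0.
rewrite /F_integrand /f1 -/e; ring.
Qed.

(** Allows dividing by the constant, to recover integrability of [F_integrand] from that of
    [f0 * v]. *)
Let c_neq0 : V * b ^- n != 0.
Proof.
rewrite !mulf_neq0 ?invr_eq0 ?expf_neq0 ?(ball_volume R n).1//.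
  by rewrite gt_eqF// powR_gt0// pi_gt0.
by rewrite gt_eqF.
Qed.

Lemma ridge_integral :
  (lebesgue_integrable (lebesgue_tuple R n.+1) (tuple_ball 1)
    (fun y => f0 (b * dott w y + b)) <->
  F_integrable n.+1 f0 (2 * b)) /\
  (F_integrable n.+1 f0 (2 * b) ->
   \int[lebesgue_tuple R n.+1]_(y in tuple_ball 1) f0 (b * dott w y + b) =
   pi `^ e * b ^- n.+1 * F n.+1 f0 (2 * b)).
Proof.
have [phi [psi [iso phiE]]] := ridge_iso w1 b_gt0.
have capE : phi @^-1` cap = tuple_ball 1.
  apply/seteqP; split => y; have [p1 p2] := phiE y;
    rewrite /tuple_ball /cap /= p1 p2 addrK mulrAC divff ?gt_eqF// mul1r;
    by rewrite ltrD2r.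
have GE : (f0 \o fst) \o phi = fun y => f0 (b * dott w y + b).
  by apply/funext => y /=; rewrite (phiE y).1.
have mI : measurable (`]0, 2 * b[%classic : set RT) by exact: measurable_itv.
have cylP : lebesgue_integrable lambda setT (fun u => f0 u * v u) <->
    F_integrable n.+1 f0 (2 * b).
  rewrite cylinderE; split => [/(lebesgue_integrable_mkcond _ _ mI).2|].
    move=> /(lebesgue_integrableZl (V * b ^- n)^-1 mI).
    by apply: eq_lebesgue_integrable => u _; rewrite mulKf.
  move=> iF; apply/(lebesgue_integrable_mkcond _ _ mI).
  exact: lebesgue_integrableZl.
have [b0' sc _ _ _] := iso.
have main : lebesgue_integrable (lebesgue_tuple R n.+1) (tuple_ball 1)
    (fun y => f0 (b * dott w y + b)) <-> F_integrable n.+1 f0 (2 * b).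
  rewrite -capE -GE (lebesgue_integrable_iso _ iso measurable_cap) -cylP; split.
    by case/(cylinder_integrable measurable_cap cap_section).
  exact: (integrable_cylinder measurable_cap cap_section).
split=> // iF.
have icap : lebesgue_integrable (prodL n) cap (f0 \o fst).
  exact/(integrable_cylinder measurable_cap cap_section)/cylP.
have := Rintegral_scales (ltW b0') sc measurable_cap icap.
rewrite capE => intE.
transitivity (b^-1 * \int[prodL n]_(p in cap) (f0 \o fst) p).
  by rewrite -intE -GE.
rewrite (cylinder_integrable measurable_cap cap_section icap).2 cylinderE.
(* The [b^-1] of the change of variables joins the [b ^- n] of the sections, and the [Gamma] in [V]
   is the one that normalizes [F]. *)
rewrite -Rintegral_mkcond lebesgue_RintegralZl// /F /V exprS invfM; ring.
Qed.

End RidgeFunctions.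

(** * Heights along the chord and tangency *)

Section Tangency.
Variables (R : realType) (m : nat) (theta : 'rV[R]_m.+1) (xi : {vspace 'rV[R]_m.+1}).
Local Notation RT := (measurableTypeR R).
Local Notation t := (last_coord theta).
Local Notation c := (Num.sqrt (1 - t ^+ 2)).

(** The coordinates, in the basis [onb xi], of the orthogonal projection of [e_n] to [xi]. *)
Definition onb_heights : (\dim xi).-tuple RT :=
  [tuple last_coord (tnth (onb xi) i) | i < \dim xi].

Local Notation w := onb_heights.

Let onbP : orthonormal_basis xi (onb xi).
Proof. exact: (xchooseP (orthonormal_basis_exists xi)). Qed.

Lemma last_coord_onb_point (y : (\dim xi).-tuple RT) :
  last_coord (onb_point y) = dott w y.
Proof.
rewrite /last_coord /onb_point summxE; apply: eq_bigr => i _.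
by rewrite mxE tnth_mktuple mulrC.
Qed.

Lemma dotv_onb_point (y : (\dim xi).-tuple RT) :
  dotv (onb_point y) (onb_point y) = dott y y.
Proof.
have /andP[_ /forallP on] := onbP.
rewrite dotv_suml; apply: eq_bigr => i _.
rewrite dotvZl dotvC dotv_suml; congr (_ * _).
rewrite (bigD1 i)//= big1 ?addr0 => [|j ji].
  by rewrite dotvZl; have /forallP/(_ i)/eqP -> := on i; rewrite eqxx mulr1.
by rewrite dotvZl; have /forallP/(_ i)/eqP -> := on j; rewrite (negPf ji) mulr0.
Qed.

Lemma onb_point_mem (y : (\dim xi).-tuple RT) : onb_point y \in xi.
Proof.
have /andP[/span_basis bas _] := onbP.
apply: memv_suml => i _; apply: memvZ.
have := memv_span (mem_tnth i (onb xi)); by rewrite bas.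
Qed.

Lemma onb_point_surj eta : eta \in xi ->
  exists y : (\dim xi).-tuple RT, eta = onb_point y.
Proof.
have /andP[bas _] := onbP => etaxi.
exists [tuple coord (onb xi) i eta | i < \dim xi].
rewrite {1}(coord_basis bas etaxi); apply: eq_bigr => i _.
by rewrite tnth_mktuple (tnth_nth 0).
Qed.

Lemma unit_ball_onb_point (y : (\dim xi).-tuple RT) :
  unit_ball (onb_point y) <-> tuple_ball 1 y.
Proof.
rewrite /unit_ball /tuple_ball /= /enorm dotv_onb_point.
by rewrite -[X in _ < X <-> _]sqrtr1 ltr_sqrt.
Qed.

Lemma last_coord_chord_point (y : (\dim xi).-tuple RT) :
  last_coord (chord_point theta (onb_point y)) = t * dott w y + c * t.
Proof. by rewrite /chord_point -last_coord_onb_point /last_coord !mxE. Qed.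

Lemma chord_onb_point (y : (\dim xi).-tuple RT) : tuple_ball 1 y ->
  chord theta xi (chord_point theta (onb_point y)).
Proof.
move=> y1; exists (onb_point y) => //; split; first exact/unit_ball_onb_point.
exact: onb_point_mem.
Qed.

(** At coordinates [y] the height is [t * (dott w y + c)], with infimum [t * (c - |w|)] over the
    unit ball. Inclusion in the half ball forces [|w| <= c]; a point of the closure at height 0
    forces [|w| >= c]. *)
Lemma tangent_heights : 0 < t < 1 -> tangent_to_equator (chord theta xi) ->
  dott w w = 1 - t ^+ 2.
Proof.
move=> /andP[t0 t1] [hsub [p [/seteqP[_ /(_ p erefl)]]]].
move=> [clp [_ p0]].
have c2 : c ^+ 2 = 1 - t ^+ 2 by rewrite sqr_sqrtr// subr_ge0 expr_le1// ltW.
have c0 : 0 < c by rewrite sqrtr_gt0 subr_gt0 expr_lt1// ltW.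
apply/eqP; rewrite -c2 eq_le; apply/andP; split; rewrite leNgt; apply/negP => wc.
  have w0 : 0 < dott w w by apply: le_lt_trans wc; exact: sqr_ge0.
  (* The multiple of [w] with [dott w y = - c], hence at height 0; its norm [c / |w|] is below 1
     when [|w| > c]. *)
  pose y : (\dim xi).-tuple RT := [tuple - (c / dott w w) * tnth w i | i < \dim xi].
  have dy (u : (\dim xi).-tuple RT) : dott u y = - (c / dott w w) * dott u w.
    by rewrite /dott mulr_sumr; apply: eq_bigr => i _; rewrite tnth_mktuple mulrCA.
  have y1 : tuple_ball 1 y.
    rewrite /tuple_ball /= dy dottC dy.
    have -> : - (c / dott w w) * (- (c / dott w w) * dott w w) = c ^+ 2 / dott w w.
      by field; rewrite gt_eqF.
    by rewrite ltr_pdivrMr// mul1r.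
  have [_] := hsub _ (chord_onb_point y1).
  rewrite last_coord_chord_point dy mulNr divfK ?gt_eqF//.
  by rewrite mulrN mulrC addNr ltxx.
(* [0 <= |w + c y|^2] bounds [dott w y] below on the unit ball. *)
have d0 : 0 < t * ((c ^+ 2 - dott w w) / (2 * c)).
  by rewrite mulr_gt0// divr_gt0 ?subr_gt0// mulr_gt0.
(* The bound gives [2 * c * (dott w y + c) >= c ^+ 2 - dott w w], so no chord point lies in this
   neighbourhood, whereas [p] is in the closure of the chord. *)
have nb : nbhs p [set x | last_coord x < t * ((c ^+ 2 - dott w w) / (2 * c))].
  apply: (@coord_continuous R 1 m.+1 0 ord_max p
    [set s | s < t * ((c ^+ 2 - dott w w) / (2 * c))]).
  by apply: lt_nbhsl; rewrite [X in X < _]p0.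
have [x [[eta [eta1 etaxi] <-]]] := clp _ nb.
have [y yE] := onb_point_surj etaxi.
move: eta1; rewrite yE /= => /unit_ball_onb_point; rewrite /tuple_ball /= => y1.
rewrite last_coord_chord_point => lt.
pose z : (\dim xi).-tuple RT := [tuple tnth w i + c * tnth y i | i < \dim xi].
have := dott_ge0 z; rewrite dott_shear dottC dott_shear dottC (dottC _ y) dott_shear.
rewrite (dottC y w) => z0; move: lt; rewrite [c * t]mulrC -mulrDr ltr_pM2l//.
rewrite ltr_pdivlMr ?mulr_gt0// => lt.
have : c ^+ 2 * dott y y <= c ^+ 2 by rewrite ler_piMr ?sqr_ge0// ltW.
move: z0 lt; move: (dott w y) (dott w w) (dott y y) => q r s z0 lt.
nra.
Qed.

End Tangency.

(** * Specialization to the chord *)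

(** Frees the dimension from its successor form, so that [k] can be [\dim xi]. *)
Lemma ridge_integral_tuple (R : realType) k (b : R)
    (w : k.-tuple (measurableTypeR R)) (f0 : R -> R) :
  (0 < k)%N -> 0 < b -> dott w w = 1 ->
  (lebesgue_integrable (lebesgue_tuple R k) (tuple_ball 1)
    (fun y => f0 (b * dott w y + b)) <-> F_integrable k f0 (2 * b)) /\
  (F_integrable k f0 (2 * b) ->
   \int[lebesgue_tuple R k]_(y in tuple_ball 1) f0 (b * dott w y + b) =
   pi `^ ((k%:R - 1) / 2) * b ^- k * F k f0 (2 * b)).
Proof. by case: k w => // n w _ b0 w1; exact: ridge_integral. Qed.

(** The square of one coordinate is at most the squared norm 1; at [theta_n = 1] the geodesic
    distance to [e_n] would be [acos 1 = 0], against its strict lower bound. *)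
Lemma sphere_Aplus_last_coord (R : realType) m (theta : 'rV[R]_m.+1) :
  sphere_Aplus theta -> 0 < last_coord theta < 1.
Proof.
move=> [[th1 t0] /andP[d0 _]]; rewrite t0 /= lt_neqAle; apply/andP; split.
  apply: contraTneq d0 => t1; rewrite /geodesic_dist.
  suff -> : dotv (e_last R m) theta = 1 by rewrite acos1 ltxx.
  rewrite /dotv (bigD1 ord_max)//= big1 ?addr0 => [|i /negPf im].
    by rewrite mxE !eqxx mul1r.
  by rewrite mxE im andbF mul0r.
rewrite -(ler_pXn2r (n := 2)) ?nnegrE ?(ltW t0)// expr1n.
have <- : dotv theta theta = 1.
  by rewrite -[LHS]sqr_sqrtr ?dotv_ge0// [Num.sqrt _]th1 expr1n.
rewrite /dotv (bigD1 ord_max)//= -expr2 lerDl sumr_ge0// => i _.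
by rewrite -expr2 sqr_ge0.
Qed.

(* The ambient dimension is [n = m.+1]. *)
Theorem lemma4p2 (R : realType) (m k : nat)
    (hn : (2 <= m.+1)%N) (hk : (1 <= k <= m.+1 - 1)%N)
    (theta : 'rV[R]_m.+1) (htheta : sphere_Aplus theta)
    (xi : {vspace 'rV[R]_m.+1}) (hxi : grassmannian_perp k theta xi)
    (htangent : tangent_to_equator (chord theta xi))
    (f : 'rV[R]_m.+1 -> R) (f0 : R -> R)
    (hf : forall x, half_ball x -> f x = f0 (last_coord x)) :
  let theta_n := last_coord theta in
  let a := pi `^ ((k%:R - 1) / 2) * (1 - theta_n ^+ 2) `^ (- (k%:R / 2)) in
  let b := theta_n * Num.sqrt (1 - theta_n ^+ 2) in
  chord_integrable f theta xi \/ F_integrable k f0 (2 * b) ->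
  [/\ chord_integrable f theta xi,
      F_integrable k f0 (2 * b) &
      chord_integral f theta xi = a * F k f0 (2 * b)].
Proof.
move=> t a b; have t01 := sphere_Aplus_last_coord htheta.
have hw := tangent_heights t01 htangent; have /andP[t0 t1] := t01.
case: hxi => dim_xi _; subst k; have /andP[k0 _] := hk.
pose c := Num.sqrt (1 - t ^+ 2).
have c2_gt0 : 0 < 1 - t ^+ 2 by rewrite subr_gt0 expr_lt1// ltW.
have c0 : 0 < c by rewrite sqrtr_gt0.
have c2 : c ^+ 2 = 1 - t ^+ 2 by rewrite sqr_sqrtr// ltW.
have b0 : 0 < b by rewrite mulr_gt0.
pose w : (\dim xi).-tuple (measurableTypeR R) :=
  [tuple c^-1 * tnth (onb_heights xi) i | i < \dim xi].
have dw y : dott w y = c^-1 * dott (onb_heights xi) y.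
  by rewrite /dott mulr_sumr; apply: eq_bigr => i _; rewrite tnth_mktuple mulrA.
have w1 : dott w w = 1.
  rewrite dw dottC dw hw -c2; field; by rewrite gt_eqF.
have ballE : ball_coords (xi := xi) = tuple_ball 1.
  by apply/seteqP; split => y /unit_ball_onb_point.
(* [f] is prescribed on the half ball, and tangency places the whole chord there. *)
have integrandE : {in tuple_ball 1, chord_integrand f theta (xi := xi) =1
    fun y => f0 (b * dott w y + b)}.
  move=> y; rewrite inE => y1; rewrite /chord_integrand hf.
    rewrite last_coord_chord_point dw /b -/t -/c; congr f0; field.
    by rewrite gt_eqF.
  exact: (htangent.1 _ (chord_onb_point theta y1)).
have integrandE' := fun y hy => esym (integrandE y hy).
have [intP intE] := ridge_integral_tuple f0 k0 b0 w1.
have chordP : chord_integrable f theta xi <-> F_integrable (\dim xi) f0 (2 * b).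
  rewrite -intP /chord_integrable ballE.
  by split; exact: eq_lebesgue_integrable.
move=> /= hor; have iF : F_integrable (\dim xi) f0 (2 * b).
  by case: hor => // /chordP.
split => //; first exact/chordP.
rewrite /chord_integral ballE (eq_Rintegral _ integrandE) intE//.
(* As [b = t * c], the factor [t ^ k * b ^- k] is [c ^- k], which is the power in [a]. *)
rewrite /a -/t powRN.
have -> : (1 - t ^+ 2) `^ ((\dim xi)%:R / 2) = c ^+ \dim xi.
  rewrite -c2 -(powR_mulrn 2 (ltW c0)) -powRrM mulrC divfK ?pnatr_eq0//.
  by rewrite powR_mulrn// ltW.
rewrite /b -/t -/c exprMn invfM -/(t ^+ \dim xi); field.
by rewrite !expf_neq0 ?gt_eqF.
Qed.
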